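(* Let $\mathcal B\subseteq\mathbb N$ be an infinite primitive set and assume that the window $W$ is topologically regular, i.e. $\overline{\operatorname{int}(W)}=W$. Then $X_\eta\subseteq Y$.
   Context: $\mathbb N=\{1,2,\dots\}$. $\mathcal B$ is primitive if there are no distinct $b,b'\in\mathcal B$ with $b\mid b'$. $\Delta:\mathbb Z\to\prod_{b\in\mathcal B}\mathbb Z/b\mathbb Z$, $\Delta(n)=(n \bmod b)_{b\in\mathcal B}$; $H:=\overline{\Delta(\mathbb Z)}$ (product topology); the window is $W:=\{h\in H: h_b\neq 0\ \forall b\in\mathcal B\}$; interior and closure are taken in $H$. $\eta\in\{0,1\}^{\mathbb Z}$ is the indicator function of $\mathcal F_{\mathcal B}=\mathbb Z\setminus\bigcup_{b\in\mathcal B}b\mathbb Z$, and $X_\eta$ is the closure of $\{\sigma^n\eta:n\in\mathbb Z\}$, $\sigma$ the left shift. For $x\in\{0,1\}^{\mathbb Z}$, $\operatorname{supp}x=\{n\in\mathbb Z:x(n)=1\}$, and $Y:=\{x\in\{0,1\}^{\mathbb Z}:\operatorname{card}(\operatorname{supp}x\bmod b)=b-1\text{ for all }b\in\mathcal B\}$, where $\operatorname{supp}x\bmod b$ is the image of $\operatorname{supp}x$ in $\mathbb Z/b\mathbb Z$. *)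

(* Defs.v *)
From HB Require Import structures.
From mathcomp Require Import all_boot all_order all_algebra.
From mathcomp Require Import all_classical all_reals all_analysis.

Import GRing.Theory.
Local Open Scope classical_set_scope.
Local Open Scope card_scope.
Local Open Scope ring_scope.

Definition primitive (B : set nat) : Prop :=
  forall b b' : nat, B b -> B b' -> (b %| b')%N -> b = b'.

(** The discrete group Z/bZ for b >= 1. The library type ['Z_b] is not used
    because ['Z_1] has two elements; for b >= 1, [b.-1.+1] is b. *)
Definition Zmod (b : nat) : discreteTopologicalType :=
  discrete_topology 'I_b.-1.+1.

Definition residue (b : nat) (n : int) : Zmod b := inZp `|(n %% b%:Z)%Z|%N.

Definition prodZmod (B : set nat) : topologicalType :=
  prod_topology (fun b : B => Zmod (set_val b)).

Definition Delta (B : set nat) : int -> prodZmod B :=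
  fun n => fun b : B => residue (set_val b) n.

Definition Hgroup (B : set nat) : set (prodZmod B) := closure (range (Delta B)).

(** [Hgroup B] is coerced to a type, carrying the topology induced by the product;
    [window B] is a subset of that space, so that its interior and closure are
    relative to [Hgroup B]. *)
Definition window (B : set nat) : set (Hgroup B) :=
  [set h : Hgroup B | forall b : B, (set_val h : prodZmod B) b != (0 : 'I__)].

Definition topologically_regular {T : topologicalType} (A : set T) : Prop :=
  closure (interior A) = A.

Definition Bfree (B : set nat) : set int :=
  ~` \bigcup_(b in B) range (fun k : int => b%:Z * k).

Definition configuration : topologicalType :=
  prod_topology (fun _ : int => bool).

(** The n-th power of the left shift, for any integer n. *)
Definition shiftZ (n : int) (x : configuration) : configuration :=
  fun m => x (m + n).

Definition eta (B : set nat) : configuration := fun n => n \in Bfree B.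

Definition Xeta (B : set nat) : set configuration :=
  closure (range (fun n : int => shiftZ n (eta B))).

Definition supp (x : configuration) : set int := [set n | x n = true].

Definition Y (B : set nat) : set configuration :=
  [set x | forall b : nat, B b -> residue b @` supp x #= `I_(b - 1)].

(* Main.v *)
Require Import Defs.
From mathcomp Require Import all_boot all_order all_algebra.
From mathcomp Require Import all_classical all_reals all_analysis.

(** If [r] is nonzero modulo [b], the window contains a point [h] with [h_b = r]:
    with [d = gcd(r, b)], a cluster point of [Delta (d * m_k)], where [m_k] is
    congruent to [r / d] modulo [b / d] and coprime to [k!], will do, because an
    element of [B] dividing [d * m_k] and at most [k] would divide [d], hence [b].
    By regularity the interior of the window meets the open set [{h_b = r}], so
    [eta] is 1 along an arithmetic progression inside [r + bZ]. A common period
    [N] of these progressions makes every length-[N] block of [eta] hit all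
    nonzero classes modulo [b], and this passes to the limit points of the orbit.
    A limit point cannot hit all [b] classes, since finitely many of its values
    are those of a translate of [eta]. *)

Import Order.TTheory GRing.Theory Num.Theory.
Local Open Scope classical_set_scope.
Local Open Scope card_scope.
Local Open Scope ring_scope.

(** Let [P] be the part of [M] prime to [q]. The Chinese remainder theorem gives [m] congruent to
    [a] modulo [q] and to 1 modulo [P]; the primes of [q] do not divide [m] because [a] is coprime
    to [q]. *)
Lemma exists_coprime_modn (a q M : nat) :
  coprime a q -> (0 < q)%N -> (0 < M)%N ->
  exists2 m : nat, m = a %[mod q] & coprime m M.
Proof.
move=> aq q0 M0; set P := (M`_(\pi(q)^'))%N.
have qP : coprime q P by rewrite coprime_pi' ?part_gt0 // part_pnat.
(* The summand [q * P] changes neither residue and makes [m] positive. *)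
set m := (q * P + chinese q P a 1)%N.
have mq : m = a %[mod q] by rewrite /m mulnC modnMDl; exact: chinese_modl.
have mP : m = 1 %[mod P] by rewrite /m modnMDl; exact: chinese_modr.
exists m => //; rewrite -(partnC (\pi(q)) M0) coprimeMr; apply/andP; split; last first.
  by rewrite -coprime_modl mP coprime_modl coprime1n.
rewrite coprime_sym (@pnat_coprime (\pi(q))) ?part_pnat // -coprime_pi' //.
  by rewrite coprime_sym -coprime_modl mq coprime_modl.
by rewrite /m ltn_addr // muln_gt0 q0 part_gt0.
Qed.

Lemma residue_eqE (b : nat) (m n : int) : (0 < b)%N ->
  (residue b m == residue b n) = (b%:Z %| m - n)%Z.
Proof.
move=> b0; rewrite -eqz_mod_dvd; apply/eqP/eqP => [/(congr1 val) /=|].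
  rewrite prednK // !modn_small -?ltz_nat ?gez0_abs ?modz_ge0 ?ltz_pmod //;
    try by rewrite -lt0n.
  by move=> /(congr1 Posz); rewrite !gez0_abs ?modz_ge0 // -lt0n.
by rewrite /residue => ->.
Qed.

Lemma residue_eq0 (b : nat) (n : int) : (0 < b)%N ->
  (residue b n == (0 : 'I__)) = (b%:Z %| n)%Z.
Proof.
move=> b0; rewrite -[in RHS](subr0 n) -residue_eqE //; congr (_ == _).
by apply/val_inj; rewrite /= mod0z mod0n.
Qed.

Lemma etaP (B : set nat) (n : int) : (forall b, B b -> (0 < b)%N) ->
  eta B n <-> forall b, B b -> residue b n != (0 : 'I__).
Proof.
move=> B_pos; split=> [/set_mem Bn b Bb|nB].
  rewrite residue_eq0 ?B_pos //; apply/negP => /dvdzP[k nE]; apply: Bn.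
  by exists b => //; exists k => //; rewrite mulrC.
apply/mem_set => -[b Bb [k _ nE]]; have := nB b Bb.
by rewrite residue_eq0 ?B_pos // -nE dvdz_mulr.
Qed.

Lemma nbhs_prod_coord (I : eqType) (T : I -> discreteTopologicalType)
    (f : prod_topology T) (i : I) : nbhs f [set g | g i = f i].
Proof.
have : nbhs (f i) [set f i] by rewrite nbhs_principalE.
exact: (@proj_continuous I T i f).
Qed.

(** Each [b] divides [j!] once [j >= b], so [Delta (n + j! * k_j)] tends to [Delta n] for any choice
    of [k_j]; hence some [j!] serves as [M]. *)
Lemma nbhs_Delta (B : set nat) (n : int) (V : set (prodZmod B)) :
  (forall b, B b -> (0 < b)%N) -> nbhs (Delta B n) V ->
  exists2 M : nat, (0 < M)%N & forall k : int, V (Delta B (n + M%:Z * k)).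
Proof.
move=> B_pos nV; apply: contrapT => noM.
have /choice[k kP] (j : nat) :
    exists k : int, ~ V (Delta B (n + j`!%:Z * k)).
  apply: contrapT => /forallNP k_V; apply: noM; exists j`!; first exact: fact_gt0.
  by move=> k; apply: contrapT; exact: k_V.
have cv : (fun j => Delta B (n + j`!%:Z * k j)) @ \oo --> Delta B n.
  apply/cvg_sup => i A /=.
  rewrite (@nbhsE (initial_topology _)) => -[_ [[C oC <-] Cn] sA].
  apply: filterS sA _; exists (set_val i) => // j /= ij.
  rewrite /Delta /= in Cn *; have Bi : B (set_val i) := set_valP i.
  suff -> : residue (set_val i) (n + j`!%:Z * k j) = residue (set_val i) n by [].
  apply/eqP; rewrite residue_eqE ?B_pos // addrC addKr.
  by rewrite dvdz_mulr // dvdzE dvdn_fact // B_pos.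
have [j _ /(_ j (leqnn j))] := cv V nV; exact: kP.
Qed.

Lemma window_residue (B : set nat) (b : B) (n : int) :
  (forall b, B b -> (0 < b)%N) -> primitive B ->
  residue (set_val b) n != (0 : 'I__) ->
  exists2 h : Hgroup B, window B h &
    (set_val h : prodZmod B) b = residue (set_val b) n.
Proof.
move=> B_pos B_prim nb; have Bb : B (set_val b) := set_valP b.
have b0 := B_pos _ Bb; set c := set_val b in nb Bb b0 *.
pose a := `|(n %% c%:Z)%Z|%N.
have aE : a%:Z = (n %% c%:Z)%Z by rewrite gez0_abs // modz_ge0 // -lt0n.
pose d := gcdn a c; have d0 : (0 < d)%N by rewrite gcdn_gt0 b0 orbT.
have /choice[m mP] (j : nat) :
    exists m : nat, m = a %/ d %[mod c %/ d] /\ coprime m j`!.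
  have [|||m ? ?] := @exists_coprime_modn (a %/ d) (c %/ d) j`!.
  - by rewrite /coprime -(eqn_pmul2r d0) muln_gcdl mul1n !divnK ?dvdn_gcdl ?dvdn_gcdr.
  - by rewrite divn_gt0 // dvdn_leq // dvdn_gcdr.
  - exact: fact_gt0.
  by exists m.
pose x (j : nat) : int := (d * m j)%N%:Z.
have xb j : residue c (x j) = residue c n.
  apply/eqP; rewrite residue_eqE // -eqz_mod_dvd -[(n %% _)%Z]modz_mod -aE.
  rewrite /x !modz_nat eqz_nat.
  have -> : a = (d * (a %/ d))%N by rewrite mulnC divnK // dvdn_gcdl.
  have -> : c = (d * (c %/ d))%N by rewrite mulnC divnK // dvdn_gcdr.
  by rewrite -!muln_modr (mP j).1.
have xB (j e : nat) : B e -> (e <= j)%N -> residue e (x j) != (0 : 'I__).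
  move=> Be ej; rewrite residue_eq0 ?B_pos //; apply/negP.
  rewrite dvdzE /= Gauss_dvdl; last first.
    rewrite coprime_sym (coprime_dvdr _ (mP j).2) // dvdn_fact //.
    by rewrite B_pos.
  (* Primitivity gives [e = c]; then [c] divides [d], hence [a] and [n], contrary to [nb]. *)
  move=> ed; have ec : e = c by apply: B_prim => //; apply: dvdn_trans ed (dvdn_gcdr _ _).
  move: nb; rewrite residue_eq0 //; apply/negP/negPn.
  rewrite (divz_eq n c) -aE rpredD ?dvdz_mull // dvdzE /=.
  by rewrite -[X in (X %| _)%N]ec (dvdn_trans ed) // dvdn_gcdl.
have cpt : compact [set: prodZmod B].
  have -> : [set: prodZmod B] = [set f : prodZmod B | forall e, setT (f e)].
    by apply/seteqP; split.
  apply: (@tychonoff B (fun e => Zmod (set_val e)) (fun=> setT)) => e; apply: finite_compact.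
  exact: (@finite_finset 'I_(set_val e).-1.+1).
have [h [_ hcl]] := cpt (Delta B \o x @ \oo) _ filterT.
have hH : Hgroup B h.
  by move=> V hV; apply: hcl => //; exists 0%N => // j _ /=; exists (x j).
exists (exist _ h (mem_set hH)) => [e /=|].
  (* Coordinates are locally constant, so what holds at [e] for all [j >= e] passes to the cluster
     point [h]. *)
  have := hcl [set g | g e != (0 : 'I__)] _ _ (nbhs_prod_coord _ _ h e).
  case=> [|g [gP]]; last by move: gP => /[swap] /= ->.
  by exists (set_val e) => // j /= ej; apply: xB => //; exact: set_valP.
have := hcl [set g : prodZmod B | g b = residue (set_val b) n] _ _ (nbhs_prod_coord _ _ h b).
case=> [|g [gb hg]]; last exact: etrans (esym hg) gb.
by exists 0%N => // j _; exact: xb.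
Qed.

Lemma eta_progression (B : set nat) (b : B) (n : int) :
  (forall b, B b -> (0 < b)%N) -> primitive B ->
  topologically_regular (window B) ->
  residue (set_val b) n != (0 : 'I__) ->
  exists a (M : nat), (0 < M)%N /\ forall k : int,
    eta B (a + M%:Z * k) /\
    residue (set_val b) (a + M%:Z * k) = residue (set_val b) n.
Proof.
move=> B_pos B_prim W_reg nb.
have [h Wh hb] := window_residue B b n B_pos B_prim nb.
have : closure (window B)° h by rewrite W_reg.
have hU : nbhs h [set g : Hgroup B | (set_val g : prodZmod B) b = residue (set_val b) n].
  have nb' : nbhs (set_val h : prodZmod B) [set f | f b = residue (set_val b) n].
    by rewrite -hb; exact: nbhs_prod_coord.
  exact: (@initial_continuous (Hgroup B) (prodZmod B) set_val h _ nb').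
move=> /(_ _ hU)[g [+ gb]]; rewrite /interior /=.
rewrite (@nbhsE (initial_topology _)) => -[_ [[C oC <-] Cg] CW].
(* The image of [Delta] is dense in [Hgroup B], so it meets this neighbourhood of [g]. *)
have [_ [[a _ <-] [Ca ab]]] : range (Delta B) `&`
    (C `&` [set f | f b = residue (set_val b) n]) !=set0.
  apply: (set_valP g); apply: filterI; first exact: open_nbhs_nbhs.
  by rewrite -gb; exact: nbhs_prod_coord.
have [|M M0 MP] := @nbhs_Delta B a (C `&` [set f | f b = residue (set_val b) n]) B_pos.
  apply: filterI; first exact: open_nbhs_nbhs.
  by rewrite -ab; exact: nbhs_prod_coord.
exists a, M; split=> // k; have [CD Db] := MP k; split=> //.
apply/etaP => // e Be.
have DH : Hgroup B (Delta B (a + M%:Z * k)) by apply: subset_closure; exists (a + M%:Z * k).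
have WD := CW (SigSub (mem_set DH)) CD.
exact: (WD (SigSub (mem_set Be))).
Qed.

(** Prescribing finitely many values is an open condition on configurations, so a translate of
    [eta B] satisfies it. *)
Lemma Xeta_window (B : set nat) (x : configuration) (I : finType) (m : I -> int) :
  Xeta B x -> exists n : int, forall i, x (m i) = eta B (m i + n).
Proof.
move=> /(_ [set y | forall i, y (m i) = x (m i)])[].
  apply: (@filter_forall _ I (fun i y => y (m i) = x (m i)) (nbhs x)) => i.
  exact: (@nbhs_prod_coord int (fun=> bool) x (m i)).
by move=> _ [[n _ <-] nP]; exists n => i; rewrite -nP.
Qed.

Lemma card_setC1_ord (n : nat) (c : 'I_n.+1) : ~` [set c] #= `I_n.
Proof.
have -> : ~` [set c] = [set lift c j | j in [set: 'I_n]].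
  apply/seteqP; split=> [j /eqP|_ [j _ <-]].
    by rewrite eq_sym => /unlift_some[k -> _]; exists k.
  by move=> /eqP; rewrite eq_sym; apply/negP; exact: neq_lift.
rewrite (card_eql (inj_card_eq _)) 1?card_eq_sym ?card_II // => j k _ _.
exact: lift_inj.
Qed.

Theorem proposition3p3 (B : set nat)
    (B_pos : forall b : nat, B b -> (0 < b)%N)
    (B_infinite : infinite_set B)
    (B_primitive : primitive B)
    (W_regular : topologically_regular (window B)) :
  Xeta B `<=` Y B.
Proof.
move=> x Xx b Bb; have b0 := B_pos b Bb.
pose bB : B := exist _ b (mem_set Bb).
have resK (i : 'I_b.-1.+1) : residue b i%:Z = i.
  have ib : (i < b)%N by rewrite -[X in (_ < X)%N](prednK b0).
  by apply/val_inj; rewrite /= modz_nat /= (modn_small ib) modn_small.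
(* [p i] holds the start and the period of a progression in class [i]; the dummy period 1 at [i = 0]
   keeps the product [N] positive. *)
have /choice[p pP] (i : 'I_b.-1.+1) : exists p : int * nat, (0 < p.2)%N /\
    (i != 0 -> forall k, eta B (p.1 + p.2%:Z * k) /\ residue b (p.1 + p.2%:Z * k) = i).
  have [->|i0] := eqVneq i 0; first by exists (0, 1%N).
  have := @eta_progression B bB i%:Z B_pos B_primitive W_regular.
  by rewrite /= resK => /(_ i0)[a [M [M0 aM]]]; exists (a, M).
pose N := (\prod_i (p i).2)%N.
have N0 : (0 < N)%N by apply: prodn_gt0 => i; case: (pP i).
have [n nP] := @Xeta_window B x 'I_N (fun i => i%:Z) Xx.
have hit (j : 'I_b.-1.+1) : j != residue b (- n) -> (residue b @` supp x) j.
  move=> jn; pose i := residue b (j%:Z + n).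
  have i0 : i != 0.
    by rewrite residue_eq0 // -[n]opprK -residue_eqE // resK.
  have Nn0 : N%:Z != 0 by rewrite -lt0n.
  (* [t] is the position in the block with [t + n] congruent to the start modulo [N]; as the period
     divides [N], [t + n] lies on the progression. *)
  pose t := `|(((p i).1 - n) %% N%:Z)%Z|%N.
  have tE : t%:Z = (((p i).1 - n) %% N%:Z)%Z by rewrite gez0_abs ?modz_ge0.
  have tN : (t < N)%N by rewrite -ltz_nat tE ltz_pmod.
  have /dvdzP[k kE] : ((p i).2%:Z %| t%:Z + n - (p i).1)%Z.
    apply: (@dvdz_trans N); first by rewrite dvdzE /N (bigD1 i) //= dvdn_mulr.
    by rewrite -addrA -[n - _]opprB -eqz_mod_dvd tE modz_mod.
  have [etan resn] := (pP i).2 i0 k.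
  have tnE : (p i).1 + (p i).2%:Z * k = t%:Z + n by rewrite mulrC -kE addrC subrK.
  rewrite tnE in etan resn.
  exists t%:Z; first by rewrite /supp /= (nP (Ordinal tN)).
  apply/eqP; rewrite -[X in _ == X]resK residue_eqE //.
  move/eqP: resn; rewrite /i residue_eqE //.
  by rewrite opprD addrACA subrr addr0.
(* Otherwise pick one position in the support per class. There [x] agrees with [eta B] translated by
   some [l], but the position in the class of [- l] lands on a multiple of [b], where [eta B]
   vanishes. *)
have [c cmiss] : exists c, ~ (residue b @` supp x) c.
  apply: contrapT => /forallNP all.
  have /choice[m mP] (j : Zmod b) : exists m : int, x m /\ residue b m = j.
    by have /contrapT[m] := all j; exists m.
  have [l lP] := @Xeta_window B x 'I_b.-1.+1 m Xx.
  have := lP (residue b (- l)); rewrite (mP _).1 => /esym/(etaP _ _ B_pos)/(_ b Bb).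
  by rewrite residue_eq0 // -[X in _ + X]opprK -residue_eqE // (mP _).2 eqxx.
have -> : residue b @` supp x = ~` [set c].
  apply/seteqP; split=> [j jx /= jc|j jc]; first by apply: cmiss; rewrite -jc.
  (* By [hit], the missed class [c] can only be that of [- n], so every other class is hit. *)
  apply/hit; apply/eqP => jn; apply: cmiss; apply/hit.
  by apply/eqP => cn; apply: jc; rewrite jn cn.
by rewrite subn1; exact: card_setC1_ord.
Qed.
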